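(* For any countable locally finite group $G$ and any unbounded increasing function $f: \mathbb{N} \to \mathbb{R}$, there exists a minimal subshift $X$ such that the quotient group $\mathrm{Aut}(X,\sigma)/\langle\sigma\rangle$ is isomorphic to $G$ and $$\frac{c_n(X)}{n f(n)} \to 0 \quad \text{as } n\to\infty.$$
   Context: A subshift is a closed subset $X \subset \mathcal{A}^{\mathbb{Z}}$, for some finite alphabet $\mathcal{A}$ (with $\mathcal{A}^{\mathbb{Z}}$ given the product topology of the discrete topology), invariant under the left shift $\sigma$ defined by $(\sigma x)(n) = x(n+1)$ (i.e. $\sigma(X)=X$). The language $L(X)$ is the set of all finite words occurring as subwords (blocks of consecutive letters) of points of $X$; $L_n(X) = L(X)\cap \mathcal{A}^n$; and $c_n(X) = |L_n(X)|$. $X$ is minimal if for all $w \in L(X)$ and all $x \in X$, $w$ is a subword of $x$. An automorphism of $X$ is a homeomorphism $\phi: X \to X$ with $\phi\circ\sigma = \sigma\circ\phi$; these form a group $\mathrm{Aut}(X,\sigma)$ under composition. Since $\sigma$ (restricted to $X$) is central in it, the subgroup $\langle\sigma\rangle$ it generates is normal. A group is locally finite if each of its finitely generated subgroups is finite. *)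

(* Defs.v *)
From HB Require Import structures.
From mathcomp Require Import all_boot all_order all_algebra.
From mathcomp Require Import all_classical all_reals all_analysis.

Set Implicit Arguments.
Unset Strict Implicit.
Unset Printing Implicit Defensive.

Import GRing.Theory.

Local Open Scope classical_set_scope.
Local Open Scope quotient_scope.
Local Open Scope group_scope.

Definition subgroup (G : groupType) (H : set G) : Prop :=
  group_closed (mem H).

Definition subgroup_gen (G : groupType) (S : set G) : set G :=
  smallest (@subgroup G) S.

Lemma subgroup_genP (G : groupType) (S : set G) : subgroup (subgroup_gen S).
Proof.
split; first by rewrite inE => H [/[dup] + [+ _] _]; rewrite inE.
move=> x y; rewrite !inE => Sx Sy H HS.
exact/set_mem/(HS.1.2 x y (mem_set (Sx H HS)) (mem_set (Sy H HS))).
Qed.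

Definition locally_finite (G : groupType) : Prop :=
  forall S : set G, finite_set S -> finite_set (subgroup_gen S).

Definition isomorphic_groups (G H : groupType) : Prop :=
  exists f : {multiplicative G -> H}, bijective f.

Record normal_subgroup (G : groupType) := NormalSubgroup {
  nsub_set :> set G;
  nsub_subgroup : subgroup nsub_set;
  nsub_conj : forall x y : G, nsub_set x -> nsub_set (x ^ y) }.

Section QuotientGroup.
Variables (G : groupType) (N : normal_subgroup G).

(* Left cosets: x N = y N. *)
Definition coset_rel : rel G := fun x y => x^-1 * y \in nsub_set N.

Let N1 : 1 \in nsub_set N. Proof. by case: (nsub_subgroup N). Qed.

Let NV x : x \in nsub_set N -> x^-1 \in nsub_set N.
Proof. exact: (group_closedV (nsub_subgroup N)). Qed.

Let NM x y : x \in nsub_set N -> y \in nsub_set N -> x * y \in nsub_set N.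
Proof. exact: (group_closedM (nsub_subgroup N)). Qed.

Let NJ x y : x \in nsub_set N -> x ^ y \in nsub_set N.
Proof. by rewrite !inE; exact: nsub_conj. Qed.

Let coset_rel_equiv : equiv_class_of coset_rel.
Proof.
split=> [x|x y|y x z]; rewrite /coset_rel ?mulVg //.
  by apply/idP/idP => /NV; rewrite invgM invgK.
by move=> /NM h /h; rewrite -mulgA mulVKg.
Qed.

Canonical coset_equiv : equiv_rel G := EquivRelPack coset_rel_equiv.

Definition quotient_group : Type := {eq_quot coset_equiv}.
HB.instance Definition _ := EqQuotient.on quotient_group.
HB.instance Definition _ := Choice.on quotient_group.

Definition quot_one : quotient_group := lift_cst quotient_group 1.
Definition quot_inv := lift_op1 quotient_group (fun x : G => x^-1).
Definition quot_mul := lift_op2 quotient_group (fun x y : G => x * y).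

Lemma quot_relP (x y : G) :
  reflect (x = y %[mod quotient_group]) (x^-1 * y \in nsub_set N).
Proof. exact: (@eqquotP _ coset_equiv quotient_group). Qed.

Lemma pi_one : \pi_quotient_group 1 = quot_one.
Proof. by rewrite /quot_one; unlock. Qed.

Lemma pi_inv : {morph \pi_quotient_group : x / x^-1 >-> quot_inv x}.
Proof.
move=> x; unlock quot_inv; apply/quot_relP; rewrite invgK.
have /quot_relP/(NJ x^-1) : x = repr (\pi_quotient_group x) %[mod quotient_group].
  by rewrite reprK.
by move=> /NV; rewrite conjgE !invgM !invgK -!mulgA mulgV mulg1.
Qed.

Lemma pi_mul : {morph \pi_quotient_group : x y / x * y >-> quot_mul x y}.
Proof.
move=> x y; unlock quot_mul; apply/quot_relP.
have /quot_relP/(NJ y) hx :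
  x = repr (\pi_quotient_group x) %[mod quotient_group] by rewrite reprK.
have /quot_relP hy :
  y = repr (\pi_quotient_group y) %[mod quotient_group] by rewrite reprK.
by move: (NM hx hy); rewrite conjgE invgM !mulgA mulgK.
Qed.

Let quot_mulA : associative quot_mul.
Proof.
by elim/quotW=> x; elim/quotW=> y; elim/quotW=> z; rewrite -!pi_mul mulgA.
Qed.

Let quot_mul1 : left_id quot_one quot_mul.
Proof. by elim/quotW=> x; rewrite -pi_one -pi_mul mul1g. Qed.

Let quot_1mul : right_id quot_one quot_mul.
Proof. by elim/quotW=> x; rewrite -pi_one -pi_mul mulg1. Qed.

Let quot_mulV : left_inverse quot_one quot_inv quot_mul.
Proof. by elim/quotW=> x; rewrite -pi_inv -pi_mul mulVg pi_one. Qed.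

Let quot_Vmul : right_inverse quot_one quot_inv quot_mul.
Proof. by elim/quotW=> x; rewrite -pi_inv -pi_mul mulgV pi_one. Qed.

HB.instance Definition _ := isGroup.Build quotient_group
  quot_mulA quot_mul1 quot_1mul quot_mulV quot_Vmul.

End QuotientGroup.

Section CentralCycle.
Variables (G : groupType) (z : G).
Hypothesis zC : forall x : G, commute z x.

Lemma central_cycle_conj (x y : G) :
  subgroup_gen [set z] x -> subgroup_gen [set z] (x ^ y).
Proof.
move=> zx; suff /conjg_fixP-> : [~ x, y] == 1 by [].
apply/commgP; apply/commute_sym.
have : [set u | commute y u] x.
  apply: zx; split; last by move=> _ ->; apply: commute_sym; exact: zC.
  split; first by rewrite inE; exact: commute1.
  move=> u v; rewrite !inE /= => yu yv.
  by apply: commuteM => //; exact: commuteV.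
by [].
Qed.

Definition central_cycle : normal_subgroup G :=
  NormalSubgroup (subgroup_genP [set z]) central_cycle_conj.
End CentralCycle.

Lemma continuous_ptws (T K : topologicalType) (I : Type)
  (f : T -> {ptws I -> K}) :
  (forall i, continuous (fun t => f t i)) -> continuous f.
Proof.
move=> cf t; apply/cvg_sup => i; move: t.
apply: (@continuous_comp_initial _ _ _ (fun y : I -> K => y i)).
exact: cf.
Qed.

Notation fullshift A := {ptws int -> discrete_topology A}.

Section Subshift.
Variable A : finType.
Local Notation fullshift := (fullshift A).

Definition shift (x : fullshift) : fullshift := fun n => x (n + 1)%R.

Record subshift := Subshift {
  subshift_set :> set fullshift;
  subshift_closed : closed subshift_set;
  subshift_shift : shift @` subshift_set = subshift_set }.

Definition subword (w : seq A) (x : fullshift) : Prop :=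
  exists k : int, w = mkseq (fun i => x (k + i%:Z)%R) (size w).

Definition language (X : set fullshift) : set (seq A) :=
  [set w | exists2 x, X x & subword w x].

Definition complexity (X : set fullshift) (n : nat) : nat :=
  #|[pred w : n.-tuple A | tval w \in language X]|.

(* The empty subshift is minimal in this sense. *)
Definition minimal (X : set fullshift) : Prop :=
  forall w x, language X w -> X x -> subword w x.

Section Automorphisms.
Variable X : subshift.

Let shift_mem (x : fullshift) : x \in subshift_set X -> shift x \in subshift_set X.
Proof. by rewrite !inE -{2}(subshift_shift X) => Xx; exists x. Qed.

(* X, seen as a type, carries the subspace topology. *)
Definition shiftX (x : X) : X := exist _ (shift (val x)) (shift_mem (valP x)).

Definition homeomorphism (phi : X -> X) : Prop :=
  continuous phi /\
  exists2 psi : X -> X, continuous psi & cancel phi psi /\ cancel psi phi.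

Definition automorphism : set (X -> X) :=
  [set phi | homeomorphism phi /\ phi \o shiftX = shiftX \o phi].

Definition Aut : Type := set_type automorphism.
HB.instance Definition _ := Choice.on Aut.

Let aut_id_mem : idfun \in automorphism.
Proof.
rewrite inE; split=> //; split; first by move=> x; exact: cvg_id.
by exists idfun => // x; exact: cvg_id.
Qed.

Let aut_comp_mem (f g : Aut) : val f \o val g \in automorphism.
Proof.
have /set_mem[[cf [f' cf' [fK f'K]]] fs] := valP f.
have /set_mem[[cg [g' cg' [gK g'K]]] gs] := valP g.
rewrite inE; split; last by rewrite -compA gs compA fs.
split; first by move=> x; apply: continuous_comp; [exact: cg|exact: cf].
exists (g' \o f'); first by move=> x; apply: continuous_comp; [exact: cf'|exact: cg'].
by split; apply: can_comp.
Qed.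

Let aut_inv_ex (f : Aut) :
  exists g : Aut, cancel (val f) (val g) /\ cancel (val g) (val f).
Proof.
have /set_mem[[cf [f' cf' [fK f'K]]] fs] := valP f.
suff f'P : f' \in automorphism by exists (exist _ f' f'P).
rewrite inE; split; first by split=> //; exists (val f).
apply/funext => x /=; apply: (can_inj fK).
by rewrite -[RHS]/((val f \o shiftX) (f' x)) fs /= !f'K.
Qed.

Definition aut_one : Aut := exist _ idfun aut_id_mem.
Definition aut_mul (f g : Aut) : Aut := exist _ (val f \o val g) (aut_comp_mem f g).
Definition aut_inv (f : Aut) : Aut := sval (cid (aut_inv_ex f)).

Let aut_mulA : associative aut_mul.
Proof. by move=> f g h; apply: val_inj. Qed.

Let aut_mul1 : left_id aut_one aut_mul.
Proof. by move=> f; apply: val_inj. Qed.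

Let aut_1mul : right_id aut_one aut_mul.
Proof. by move=> f; apply: val_inj. Qed.

Let aut_mulV : left_inverse aut_one aut_inv aut_mul.
Proof.
move=> f; apply: val_inj; apply/funext => x.
by rewrite /= /aut_inv; case: cid => g [] /= fK _; exact: fK.
Qed.

Let aut_Vmul : right_inverse aut_one aut_inv aut_mul.
Proof.
move=> f; apply: val_inj; apply/funext => x.
by rewrite /= /aut_inv; case: cid => g [] /= _; exact.
Qed.

HB.instance Definition _ := isGroup.Build Aut
  aut_mulA aut_mul1 aut_1mul aut_mulV aut_Vmul.

Let continuous_coord (f : X -> X) :
  (forall n : int, continuous (fun x : X => (val (f x) : fullshift) n
     : discrete_topology A)) -> continuous f.
Proof.
move=> cf; apply: continuous_comp_initial; apply: continuous_ptws => n.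
exact: cf.
Qed.

Let coord_continuous (n : int) :
  continuous (fun x : X => (val x : fullshift) n : discrete_topology A).
Proof.
move=> x; apply: (@continuous_comp _ _ _ (fun y : X => val y : fullshift)
  (fun y : fullshift => y n)).
  exact: initial_continuous.
exact: (@proj_continuous _ (fun=> discrete_topology A)).
Qed.

Let unshift (x : fullshift) : fullshift := fun n => x (n - 1)%R.

Let unshift_mem (x : fullshift) :
  x \in subshift_set X -> unshift x \in subshift_set X.
Proof.
rewrite !inE -{1}(subshift_shift X) => -[y Xy <-].
suff -> : unshift (shift y) = y by [].
by apply/funext => n; rewrite /unshift /shift subrK.
Qed.

Let shiftX_aut_mem : shiftX \in automorphism.
Proof.
rewrite inE; split=> //; split.
  by apply: continuous_coord => n; exact: coord_continuous.
exists (fun x : X => exist _ (unshift (val x)) (unshift_mem (valP x)) : X).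
  by apply: continuous_coord => n; exact: coord_continuous.
by split=> x; apply: val_inj; apply/funext => n /=; rewrite /shift /unshift ?addrK ?subrK.
Qed.

Definition shift_aut : Aut := exist _ shiftX shiftX_aut_mem.

Lemma shift_aut_central (f : Aut) : commute shift_aut f.
Proof.
have /set_mem[_ fs] := valP f; apply: val_inj; exact/esym/fs.
Qed.

Definition shift_subgroup : normal_subgroup Aut :=
  central_cycle shift_aut_central.

End Automorphisms.
End Subshift.

(* Main.v *)
(* Write [G] as an increasing union of finite subgroups [E n]. The subshift is generated by
   binary words [word n i], one for each label [i] in [E n * bool], all of the same length
   [len n]; a word of level [n.+1] is a concatenation of words of level [n], chosen so that left
   multiplication by [g] in [E n] on the labels of level [n.+1] induces left multiplication by [g]
   on the labels of level [n]. Points are cut into blocks of every level in a unique way, so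
   relabelling the blocks makes [G] act by automorphisms.

   Conversely, let [y] be the image of a point [x] under an automorphism, and take [n] beyond its
   coding radius. Words of level [n.+1] end with a run of one repeated word, longer than the
   rest of the word; such runs must be sent to runs, which forces the block structures of
   [x] and [y] to agree up to a translation [s], and the labels of [y] to be a function of
   those of [x]. Each word contains a copy, translated by some group element, of the list of all
   labels, so this function is a left multiplication. Hence the automorphism agrees at [x], and
   by minimality everywhere, with an element of [G] followed by a power of the shift.

   Only the length of the final run is left free. Words of length between [len n] and
   [len n.+1] number at most [slope n] times their length, where [slope n] does not
   depend on the lengths of the runs, so long runs make the complexity [o(n f(n))]. *)

From HB Require Import structures.
Require Import Defs.
From mathcomp Require Import all_boot all_order all_algebra.
From mathcomp Require Import all_classical all_reals all_analysis.
From mathcomp Require Import zify ring.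
Import Order.TTheory GRing.Theory Num.Theory.
Import numFieldNormedType.Exports.
Local Open Scope classical_set_scope.
Local Open Scope ring_scope.

Set Implicit Arguments.
Unset Strict Implicit.
Unset Printing Implicit Defensive.

(** * Sequences cut into blocks of constant length *)

Section Blocks.
Variables (T U : Type) (L : nat) (W : T -> nat -> U).

(** Used at two scales: [W] is [word] when labels are written out in bits, and [theta] when labels
    of one level are written out in labels of the level below. *)
Definition blocks (p : int) (a : int -> T) (x : int -> U) :=
  forall (k : int) (j : nat), (j < L)%N -> x (p + k * L%:Z + j%:Z) = W (a k) j.

Definition spread (p : int) (a : int -> T) (z : int) : U :=
  W (a ((z - p) %/ L%:Z)%Z) `|((z - p) %% L%:Z)%Z|%N.

Hypothesis L_gt0 : (0 < L)%N.

Lemma block_decomp (p z : int) :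
  exists (k : int) (j : nat), (j < L)%N /\ z = p + k * L%:Z + j%:Z.
Proof.
exists ((z - p) %/ L%:Z)%Z, `|((z - p) %% L%:Z)%Z|%N; split; lia.
Qed.

Lemma spreadP p a : blocks p a (spread p a).
Proof.
move=> k j jL; rewrite /spread.
have -> : p + k * L%:Z + j%:Z - p = k * L%:Z + j%:Z by lia.
rewrite divzMDl ?modzMDl; last by lia.
by rewrite divz_small ?addr0 ?modz_small //=; lia.
Qed.

Lemma blocks_translate p a x t :
  blocks p a x -> blocks (p + t * L%:Z) (fun k => a (k + t)) x.
Proof.
move=> bx k j jL; rewrite -bx //; congr x; ring.
Qed.

Lemma blocks_shift p a x s :
  blocks p a x -> blocks (p - s) a (fun z => x (z + s)).
Proof. by move=> bx k j jL; rewrite -bx //; congr x; ring. Qed.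

Lemma blocks_eq p a a' x x' : a =1 a' -> x =1 x' -> blocks p a x -> blocks p a' x'.
Proof. by move=> ea ex bx k j jL; rewrite -ex -ea bx. Qed.

End Blocks.

(** * Words indexed by finite groups *)

Section Substitutions.
Variables (G : groupType) (E : nat -> seq G) (N : nat -> nat).

Definition label := (G * bool)%type.

Definition lact (g : G) (i : label) : label := ((g * i.1)%g, i.2).

Definition labels n : seq label :=
  [seq (g, b) | g <- E n, b <- [:: false; true]].

(** [choose] depends only on the predicate, so this is a canonical representative of the right coset
    of [h] modulo [E n]; hence [part] is equivariant under left multiplication by [E n]. *)
Definition rep n (h : G) : G := choose (fun y => (y * h^-1)%g \in E n) h.

Definition part n (h : G) : G := (h * (rep n h)^-1)%g.

(* The labels composing a block of the next level, up to left multiplication by [part]: first a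
   marker with bits 1110, which occurs nowhere else because from then on every third bit is
   [false]; then all pairs of labels; then a bit [true] whose position [c] encodes the
   coset of the label and its own bit; then a last bit [true]. The default value of [nth]
   provides the run that ends the block; it starts at [hd n] and has length [N n]. *)
Definition pairs n (c : nat) : seq (label * label) :=
  ((1%g, false), (1%g, false))
  :: [seq (a, b) | a <- labels n, b <- labels n]
  ++ mkseq (fun j => ((1%g, j == c), (1%g, false))) (size (labels n.+1))
  ++ [:: ((1%g, false), (1%g, true))].

Definition template n (c j : nat) : label :=
  if (j < 3)%N then (1%g, true) else
  let ab := nth ((1%g, false), (1%g, false)) (pairs n c) (j %/ 3 - 1) in
  nth (1%g, false) [:: ab.1; ab.2] (j %% 3).

Definition code n (i : label) : nat := index (rep n i.1, i.2) (labels n.+1).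

(** The template sees only the coset of [i.1] and the bit of [i]. The translation by [part] restores
    the rest and makes [theta] commute with [E n]. *)
Definition theta n (i : label) (j : nat) : label :=
  lact (part n i.1) (template n (code n i) j).

Definition npairs n : nat := (size (labels n) ^ 2 + size (labels n.+1) + 2)%N.
(** The final 2: the pairs follow three marker positions, but the third slot of the last pair
    already belongs to the run. *)
Definition hd n : nat := (3 * npairs n + 2)%N.
Definition cnt n : nat := (hd n + N n)%N.

Fixpoint len n : nat := if n is m.+1 then (cnt m * len m)%N else 1%N.

Fixpoint word n (i : label) (j : nat) : bool :=
  if n is m.+1 then word m (theta m i (j %/ len m)) (j %% len m) else i.2.

(** The 4 in the last field keeps a run shortened by three longer than [hd n], as [constant_run]
    requires. *)
Record admissible : Prop := Admissible {
  admissible_0 : E 0 =i [:: 1%g];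
  admissible_1 : forall n, 1%g \in E n;
  admissible_div : forall n g h, g \in E n -> h \in E n -> (g * h^-1)%g \in E n;
  admissible_S : forall n g, g \in E n -> g \in E n.+1;
  admissible_large : forall n, (hd n + 4 <= N n)%N }.

(** * Labels, templates and injectivity of words *)

Hypothesis adm : admissible.

Lemma E_1 n : 1%g \in E n. Proof. exact: (admissible_1 adm). Qed.

Lemma E_div n g h : g \in E n -> h \in E n -> (g * h^-1)%g \in E n.
Proof. exact: (admissible_div adm). Qed.

Lemma E_S n g : g \in E n -> g \in E n.+1. Proof. exact: (admissible_S adm). Qed.

Lemma N_large n : (hd n + 4 <= N n)%N. Proof. exact: (admissible_large adm). Qed.

Lemma E_V n g : g \in E n -> (g^-1)%g \in E n.
Proof. by move=> gE; rewrite -[X in X \in _]mul1g E_div ?E_1. Qed.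

Lemma E_M n g h : g \in E n -> h \in E n -> (g * h)%g \in E n.
Proof. by move=> gE hE; rewrite -[h]invgK E_div // E_V. Qed.

Lemma E_le n m g : (n <= m)%N -> g \in E n -> g \in E m.
Proof.
move=> /subnKC <-; elim: (m - n)%N => [|d IH]; first by rewrite addn0.
by move=> /IH; rewrite addnS => /E_S.
Qed.

Lemma mem_labels n i : (i \in labels n) = (i.1 \in E n).
Proof.
case: i => g b; apply/allpairsP/idP => /= [[[h c]] /= [hE _ [-> _]] //|gE].
by exists (g, b); split=> //; case: b.
Qed.

Lemma lactM g h i : lact (g * h)%g i = lact g (lact h i).
Proof. by rewrite /lact mulgA. Qed.

Lemma lact1 i : lact 1%g i = i.
Proof. by rewrite /lact mul1g; case: i. Qed.

Lemma lactVK g : cancel (lact g^-1%g) (lact g).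
Proof. by move=> i; rewrite -lactM mulgV lact1. Qed.

Lemma lact_labels n g i : g \in E n -> (lact g i \in labels n) = (i \in labels n).
Proof.
move=> gE; rewrite !mem_labels /=; apply/idP/idP => [|iE]; last exact: E_M.
by move=> /(E_M (E_V gE)); rewrite mulKg.
Qed.

Lemma rep_mem n h : (rep n h * h^-1)%g \in E n.
Proof.
by rewrite /rep; apply: (@chooseP _ (fun y => (y * h^-1)%g \in E n)); rewrite mulgV E_1.
Qed.

Lemma part_mem n h : part n h \in E n.
Proof. by rewrite /part -[h]invgK -invgM E_V // invgK rep_mem. Qed.

Lemma rep_M n g h : g \in E n -> rep n (g * h)%g = rep n h.
Proof.
move=> gE; rewrite /rep.
rewrite (@eq_choose _ _ (fun y => (y * h^-1)%g \in E n)); last first.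
  move=> y; rewrite invgM mulgA; apply/idP/idP => yE; last exact: E_div.
  by move: (E_M yE gE); rewrite mulgVK.
by apply: choose_id; rewrite ?mulgV ?mulgK ?E_1.
Qed.

Lemma part_M n g h : g \in E n -> part n (g * h)%g = (g * part n h)%g.
Proof. by move=> gE; rewrite /part rep_M // mulgA. Qed.

Lemma part_rep n h : (part n h * rep n h)%g = h.
Proof. by rewrite /part mulgVK. Qed.

Lemma theta_lact n g i j : g \in E n -> theta n (lact g i) j = lact g (theta n i j).
Proof. by move=> gE; rewrite /theta /code /= rep_M // part_M // lactM. Qed.

Lemma size_pairs n c : size (pairs n c) = npairs n.
Proof.
by rewrite /npairs /= !size_cat size_allpairs size_mkseq /=; lia.
Qed.

Lemma hd_lt_cnt n : (hd n < cnt n)%N.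
Proof. by have := N_large n; rewrite /cnt; lia. Qed.

Lemma cnt_ge n : (16 <= cnt n)%N.
Proof. by have := N_large n; rewrite /cnt /hd /npairs; lia. Qed.

Lemma len_gt0 n : (0 < len n)%N.
Proof. by elim: n => //= n IH; have := cnt_ge n; nia. Qed.

Lemma len_gt n : (n < len n)%N.
Proof. by elim: n => //= n IH; have := cnt_ge n; nia. Qed.

Lemma template_marker n c j : (j < 3)%N -> template n c j = (1%g, true).
Proof. by rewrite /template => ->. Qed.

Lemma template_3 n c : template n c 3 = (1%g, false).
Proof. by []. Qed.

Lemma template_mod2 n c j : (3 <= j)%N -> (j %% 3 = 2)%N -> template n c j = (1%g, false).
Proof. by move=> j3 j2; rewrite /template j2 ltnNge j3. Qed.

Lemma template_tail n c j : (hd n <= j)%N -> template n c j = (1%g, false).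
Proof.
rewrite /template /hd => hj; case: ltnP => [|_]; first by rewrite /npairs in hj; lia.
have [j2|j2] := eqVneq (j %% 3)%N 2; first by rewrite j2.
rewrite (@nth_default _ _ (pairs n c)); last by rewrite size_pairs; lia.
by case: (j %% 3)%N => [|[|[]]].
Qed.

Lemma template_pre_tail n c : template n c (hd n).-1 = (1%g, true).
Proof.
have -> : (hd n).-1 = (3 * (npairs n) + 1)%N by rewrite /hd; lia.
rewrite /template; case: ltnP => [|_]; first by rewrite /npairs; lia.
have -> : ((3 * npairs n + 1) %% 3 = 1)%N by lia.
have -> : ((3 * npairs n + 1) %/ 3 - 1 = (npairs n).-1)%N by lia.
rewrite -(size_pairs n c) (@nth_last _ _ (pairs n c)).
by rewrite /pairs last_cons !last_cat.
Qed.

Lemma template_pair n a b : a \in labels n -> b \in labels n ->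
  exists j, [/\ (3 <= j)%N, (j + 3 < hd n)%N &
    forall c, template n c j = a /\ template n c j.+1 = b].
Proof.
move=> an bn.
have ab : (a, b) \in [seq (a, b) | a <- labels n, b <- labels n].
  by apply/allpairsP; exists (a, b).
set l := [seq _ | a <- _, b <- _] in ab.
have il : (index (a, b) l < size (labels n) ^ 2)%N.
  by have := ab; rewrite -index_mem /l size_allpairs; lia.
(* Two groups of three positions come first: the marker and the leading pair of [false] labels. *)
exists (3 * (index (a, b) l).+2)%N; split; [lia|rewrite /hd /npairs; lia|].
move=> c'; rewrite /template.
have -> : (3 * (index (a, b) l).+2 < 3 = false)%N by lia.
have -> : ((3 * (index (a, b) l).+2).+1 < 3 = false)%N by lia.
have -> : ((3 * (index (a, b) l).+2) %/ 3 - 1 = (index (a, b) l).+1)%N by lia.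
have -> : ((3 * (index (a, b) l).+2).+1 %/ 3 - 1 = (index (a, b) l).+1)%N by lia.
have -> : ((3 * (index (a, b) l).+2) %% 3 = 0)%N by lia.
have -> : ((3 * (index (a, b) l).+2).+1 %% 3 = 1)%N by lia.
rewrite /= -/l nth_cat index_mem ab nth_index //=.
Qed.

Lemma template_code n c t : (t < size (labels n.+1))%N ->
  template n c (3 * (size (labels n) ^ 2 + t + 2)) = (1%g, t == c).
Proof.
move=> tl; rewrite /template.
set s := size (labels n); have -> : (3 * (s ^ 2 + t + 2) < 3 = false)%N by lia.
have -> : ((3 * (s ^ 2 + t + 2)) %/ 3 - 1 = (s ^ 2 + t).+1)%N by lia.
have -> : ((3 * (s ^ 2 + t + 2)) %% 3 = 0)%N by lia.
rewrite /= nth_cat size_allpairs -/s mulnn ltnNge leq_addr /= addKn.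
by rewrite nth_cat size_mkseq tl nth_mkseq.
Qed.

Lemma template_in n c j : (template n c j).1 \in E n.
Proof.
rewrite /template; case: ifP => [_|_]; first exact: E_1.
set ab := nth _ (pairs n c) _.
have : (ab.1.1 \in E n) && (ab.2.1 \in E n).
  have [lj|lj] := ltnP (j %/ 3 - 1) (size (pairs n c)); last first.
    by rewrite /ab nth_default //= E_1.
  have := mem_nth ((1%g, false), (1%g, false)) lj; rewrite -/ab /pairs.
  rewrite in_cons mem_cat mem_cat => /or4P[/eqP->|/allpairsP[[a b] /= [+ +] ->]|/mapP[k _ ->]|].
  - by rewrite /= E_1.
  - by rewrite !mem_labels => -> ->.
  - by rewrite /= E_1.
  - by rewrite inE => /eqP -> /=; rewrite E_1.
by case/andP => a1 b1; case: (j %% 3)%N => [|[|[|]]] //=; rewrite ?E_1.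
Qed.

Lemma theta_labels n i j : theta n i j \in labels n.
Proof. by rewrite /theta lact_labels ?part_mem // mem_labels template_in. Qed.

Lemma theta_bit n i j : (theta n i j).2 = (template n (code n i) j).2.
Proof. by []. Qed.

(** [part] and [rep] multiply back to the group element. As [rep] stays in [E n.+1], the index
    [code] points inside the list and determines [rep] and the bit. *)
Lemma code_inj n i i' : i \in labels n.+1 -> i' \in labels n.+1 ->
  code n i = code n i' -> part n i.1 = part n i'.1 -> i = i'.
Proof.
move=> il i'l ec ep.
have m1 h : h \in E n.+1 -> rep n h \in E n.+1.
  move=> hE; have -> : rep n h = (rep n h * h^-1 * h)%g by rewrite mulgVK.
  by apply: E_M => //; apply: E_S; exact: rep_mem.
have : (rep n i.1, i.2) = (rep n i'.1, i'.2).
  have ri : (rep n i.1, i.2) \in labels n.+1.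
  by rewrite mem_labels /=; apply: m1; rewrite -mem_labels.
  rewrite -(nth_index (1%g, false) ri) -/(code n i) ec nth_index // mem_labels /=.
  by apply: m1; rewrite -mem_labels.
case=> er e2; rewrite (surjective_pairing i) (surjective_pairing i') e2.
by rewrite -(part_rep n i.1) -(part_rep n i'.1) er ep.
Qed.

(* The margin of three positions absorbs the displacement [tau + e] met in
   [locally_determined_relabel]. *)
Lemma theta_inj_interior n i i' : i \in labels n.+1 -> i' \in labels n.+1 ->
  (forall j, (3 <= j)%N -> (j + 3 < hd n)%N -> theta n i j = theta n i' j) -> i = i'.
Proof.
move=> il i'l e.
have ci u : u \in labels n.+1 -> (code n u < size (labels n.+1))%N.
  move=> ul; rewrite index_mem mem_labels /=.
  have -> : rep n u.1 = (rep n u.1 * u.1^-1 * u.1)%g by rewrite mulgVK.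
  by apply: E_M; [apply: E_S; exact: rep_mem | rewrite -mem_labels].
have cl := ci _ il.
(* At this position the letter of [i] is [part] with bit [true], and the bit of the letter of [i']
   tests whether the two codes coincide. *)
have : theta n i (3 * (size (labels n) ^ 2 + code n i + 2)) =
       theta n i' (3 * (size (labels n) ^ 2 + code n i + 2)).
  by apply: e; rewrite /hd /npairs; lia.
rewrite /theta !template_code // eqxx /lact /= !mulg1 => -[ep /esym/eqP ec].
exact: (code_inj il i'l ec ep).
Qed.

Lemma theta_inj n i i' : i \in labels n.+1 -> i' \in labels n.+1 ->
  (forall j, (j < cnt n)%N -> theta n i j = theta n i' j) -> i = i'.
Proof.
move=> il i'l e; apply: (theta_inj_interior il i'l) => j j3 jh; apply: e.
by have := hd_lt_cnt n; lia.
Qed.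

Lemma word_inj n i i' : i \in labels n -> i' \in labels n ->
  (forall j, (j < len n)%N -> word n i j = word n i' j) -> i = i'.
Proof.
elim: n i i' => [|n IH] i i' il i'l e.
  have := e 0 isT; move: il i'l; rewrite !mem_labels !(admissible_0 adm) !inE.
  by case: i i' {e} => [g b] [g' b'] /= /eqP-> /eqP-> ->.
apply: (theta_inj il i'l) => j jc; apply: IH; try exact: theta_labels.
move=> j' j'l; have := e (j * len n + j')%N.
rewrite /= divnMDl ?len_gt0 // divn_small // addn0 modnMDl modn_small //.
by apply; nia.
Qed.

(** * Parsings of sequences and their uniqueness *)

Definition parse n (p : int) (a : int -> label) (x : int -> bool) :=
  (forall k, a k \in labels n) /\ blocks (len n) (word n) p a x.

Lemma parse_translate n p a x t :
  parse n p a x -> parse n (p + t * (len n)%:Z) (fun k => a (k + t)) x.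
Proof. by case=> al bx; split=> [k|]; [exact: al | exact: blocks_translate]. Qed.

Lemma parse_down n p v u x : blocks (cnt n) (theta n) 0 v u ->
  parse n.+1 p v x -> parse n p u x.
Proof.
move=> bu [vl bx]; have cn := cnt_ge n; have c0 : (0 < cnt n)%N by lia.
have ue k : exists k1 j1,
    [/\ (j1 < cnt n)%N, k = k1 * (cnt n)%:Z + j1%:Z & u k = theta n (v k1) j1].
  have [k1 [j1 [j1c ek]]] := block_decomp c0 0 k.
  exists k1, j1; split=> //; first by rewrite ek; ring.
  by rewrite ek bu.
split=> [k|k j jl]; have [k1 [j1 [j1c ek ->]]] := ue k; first exact: theta_labels.
have := bx k1 (j1 * len n + j)%N.
rewrite /= divnMDl ?len_gt0 // divn_small // addn0 modnMDl modn_small //.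
move=> <-; last by nia.
by congr x; rewrite ek; lia.
Qed.

Lemma parse_local n p a a' x x' k : parse n p a x -> parse n p a' x' ->
  (forall j, (j < len n)%N ->
     x (p + k * (len n)%:Z + j%:Z) = x' (p + k * (len n)%:Z + j%:Z)) ->
  a k = a' k.
Proof.
move=> [al bx] [a'l bx'] e; apply: (word_inj (al k) (a'l k)) => j jl.
by rewrite -bx // -bx' // e.
Qed.

Lemma parse_label_uniq n p a a' x : parse n p a x -> parse n p a' x -> a =1 a'.
Proof. by move=> pa pa' k; apply: (parse_local pa pa'). Qed.

Lemma marker_bits n q v u k (j : nat) : blocks (cnt n) (theta n) q v u -> (j < 3)%N ->
  (u (q + k * (cnt n)%:Z + j%:Z)).2.
Proof.
move=> bu j3; rewrite bu; first by rewrite theta_bit template_marker.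
by have := cnt_ge n; lia.
Qed.

(** The run has bits [false]; from position 3 on, any three consecutive positions include one
    congruent to 2 modulo 3, where the bit is [false]; and a window starting at 1 or 2 reaches
    position 3, also [false]. *)
Lemma markerP n q v u z : blocks (cnt n) (theta n) q v u ->
  (u z).2 -> (u (z + 1)).2 -> (u (z + 2)).2 -> exists k, z = q + k * (cnt n)%:Z.
Proof.
move=> bu; have cn := cnt_ge n; have c0 : (0 < cnt n)%N by lia.
have [k [j [jc ->]]] := block_decomp c0 q z.
have bit (i : nat) : (j + i < cnt n)%N ->
    (u (q + k * (cnt n)%:Z + j%:Z + i%:Z)).2 = (template n (code n (v k)) (j + i)).2.
  by move=> ji; rewrite -theta_bit -bu //; congr (u _).2; lia.
case: (posnP j) => [-> _ _ _|j0]; first by exists k; rewrite addr0.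
have hN := N_large n; rewrite /cnt in bit jc.
have [jh|jh] := leqP (hd n) j.
  by have := bit 0 ltac:(lia); rewrite addr0 addn0 => ->; rewrite template_tail.
move=> h0 h1 h2; exfalso.
have t_ i : (i < 3)%N -> (template n (code n (v k)) (j + i)).2.
  case: i => [|[|[|//]]] _; rewrite -bit ?addr0 //; lia.
have [j3|j3] := leqP 3 j.
  have [i [i3 ji]] : exists i, (i < 3)%N /\ ((j + i) %% 3 = 2)%N.
    by exists (2 - j %% 3)%N; lia.
  by have := t_ i i3; rewrite template_mod2 //; lia.
have := t_ (3 - j)%N; have -> : (j + (3 - j) = 3)%N by lia.
by move=> /(_ ltac:(lia)); rewrite template_3.
Qed.

(* The window is long enough to show the marker of a block of each level up to [n]. *)
Lemma parse_recognizable n p p' a a' x x' (s : int) : parse n p a x -> parse n p' a' x' ->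
  (forall z : int, s <= z < s + 2 * (len n)%:Z -> x z = x' z) ->
  exists t, p' = p + t * (len n)%:Z.
Proof.
elim: n p p' a a' x x' s => [|n IH] p p' a a' x x' s px px' e.
  by exists (p' - p); rewrite mulr1; ring.
have cn := cnt_ge n; have c0 : (0 < cnt n)%N by lia.
have l0 := len_gt0 n.
have LE : (len n.+1)%:Z = (cnt n)%:Z * (len n)%:Z by rewrite -PoszM.
have lL : 16 * (len n)%:Z <= (len n.+1)%:Z by rewrite LE; nia.
have bu := spreadP (theta n) c0 0 a; have pu := parse_down bu px.
have bu' := spreadP (theta n) c0 0 a'; have pu' := parse_down bu' px'.
move: (spread _ _ _ _) (spread _ _ _ _) bu bu' pu pu' => u' u bu bu' pu pu'.
have [t tE] : exists t, p' = p + t * (len n)%:Z.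
  by apply: (IH _ _ _ _ _ _ s pu pu') => z zs; apply: e; lia.
have pt := parse_translate (- t) pu'; rewrite tE mulNr addrK in pt.
have uu z : s <= p + z * (len n)%:Z -> p + (z + 1) * (len n)%:Z <= s + 2 * (len n.+1)%:Z ->
    u z = u' (z - t).
  move=> h1 h2; apply: (parse_local pu pt) => j jl; apply: e.
  by apply/andP; split; lia.
(* The block after the one containing [s - 1] starts in the first half of the window, so its marker
   is visible in both sequences. *)
have [k [j [jl sE]]] := block_decomp (len_gt0 n.+1) p (s - 1).
have [k' k'E] : exists k', (k + 1) * (cnt n)%:Z - t = 0 + k' * (cnt n)%:Z.
  have mk (i : nat) : (i < 3)%N -> (u' ((k + 1) * (cnt n)%:Z - t + i%:Z)).2.
    have kL : k * (len n.+1)%:Z = k * (cnt n)%:Z * (len n)%:Z by rewrite LE mulrA.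
    move=> i3; have := marker_bits (k + 1) bu i3; rewrite add0r uu; first by rewrite addrAC.
      by move: sE jl; case: i i3 => [|[|[|//]]] _; lia.
    by move: sE jl; case: i i3 => [|[|[|//]]] _; lia.
  by apply: (markerP bu'); [have := mk 0; rewrite addr0; apply|exact: (mk 1)|exact: (mk 2)].
exists (k + 1 - k'); rewrite tE; congr (_ + _) => /=.
by rewrite PoszM mulrA mulrBl; congr (_ * _); lia.
Qed.

Lemma parse_uniq n p p' a a' x : parse n p a x -> parse n p' a' x ->
  exists t, p' = p + t * (len n)%:Z /\ forall k, a' k = a (k + t).
Proof.
move=> px px'; have [t tE] := parse_recognizable (s := 0) px px' (fun _ _ => erefl).
exists t; split=> // k; have := parse_translate t px; rewrite -tE => pt.
exact: parse_label_uniq px' pt k.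
Qed.

(** * Relabelling blocks by a group element *)

Definition relabel n (g : G) (x y : int -> bool) :=
  exists p a, parse n p a x /\ parse n p (fun k => lact g (a k)) y.

Lemma relabel_down n g x y : g \in E n -> relabel n.+1 g x y -> relabel n g x y.
Proof.
move=> gE [p [v [px py]]]; have c0 : (0 < cnt n)%N by have := cnt_ge n; lia.
have bu := spreadP (theta n) c0 0 v.
exists p, (spread (cnt n) (theta n) 0 v); split; first exact: parse_down px.
apply: parse_down py => k j jc.
by rewrite theta_lact // -bu.
Qed.

Lemma relabel_le n m g x y : (n <= m)%N -> g \in E n ->
  relabel m g x y -> relabel n g x y.
Proof.
move=> /subnKC <-; elim: (m - n)%N => [|d IH]; first by rewrite addn0.
move=> gE; rewrite addnS => /relabel_down h; apply: IH => //; apply: h.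
by apply: E_le gE; exact: leq_addr.
Qed.

Lemma relabel_ex n g p a x : g \in E n -> parse n p a x -> exists y, relabel n g x y.
Proof.
move=> gE px; exists (spread (len n) (word n) p (fun k => lact g (a k))), p, a.
split=> //; split; last exact: spreadP (len_gt0 n) _ _.
by move=> k; rewrite lact_labels //; case: px.
Qed.

(** The window after [z] fixes the cuts by recognizability; the block containing [z] lies within
    [len n] of [z], so its label can be read as well. *)
Lemma relabel_local n g x y x' y' z : relabel n g x y -> relabel n g x' y' ->
  (forall t : int, - (2 * (len n)%:Z) <= t <= 2 * (len n)%:Z -> x (z + t) = x' (z + t)) ->
  y z = y' z.
Proof.
move=> [p [a [px py]]] [p' [a' [px' py']]] e.
have e' (i : int) : z - 2 * (len n)%:Z <= i <= z + 2 * (len n)%:Z -> x i = x' i.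
  move=> hi; have := e (i - z); have -> : z + (i - z) = i by ring.
  by apply; lia.
have [t tE] : exists t, p = p' + t * (len n)%:Z.
  apply: (parse_recognizable (s := z) px' px) => i hi; apply/esym/e'; lia.
have := parse_translate t px'; have := parse_translate t py'.
rewrite -tE => qy' qx'.
have [k [j [jl zE]]] := block_decomp (len_gt0 n) p z.
rewrite zE (proj2 py) // (proj2 qy') //; congr (word n (lact g _) j).
apply: (parse_local px qx') => i il; apply: e'; rewrite zE; lia.
Qed.

Lemma relabel_uniq n g x y y' : relabel n g x y -> relabel n g x y' -> y =1 y'.
Proof. by move=> r r' z; exact: relabel_local r r' _. Qed.

Lemma relabel_comp n g h x y z : relabel n h x y -> relabel n g y z ->
  relabel n (g * h)%g x z.
Proof.
move=> [p [a [px py]]] [p' [a' [py' pz]]]; exists p, a; split=> //.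
have [t [tE aE]] := parse_uniq py' py.
have := parse_translate t pz; rewrite -tE => -[zl bz]; split.
  by move=> k; rewrite lactM aE; exact: zl.
by apply: blocks_eq bz => // k; rewrite lactM aE.
Qed.

Lemma relabel_1 n p a x : parse n p a x -> relabel n 1%g x x.
Proof.
move=> px; exists p, a; split=> //; case: px => al bx; split=> [k|]; first by rewrite lact1.
by apply: blocks_eq bx => // k; rewrite lact1.
Qed.

Lemma parse_shift n p a x s : parse n p a x -> parse n (p - s) a (fun z => x (z + s)).
Proof. by case=> al bx; split=> //; exact: blocks_shift. Qed.

Lemma relabel_shift n g x y s : relabel n g x y ->
  relabel n g (fun z => x (z + s)) (fun z => y (z + s)).
Proof. by move=> [p [a [px py]]]; exists (p - s), a; split; exact: parse_shift. Qed.

Lemma parse_ext n p a x x' : x =1 x' -> parse n p a x -> parse n p a x'.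
Proof. by move=> e [al bx]; split=> //; exact: blocks_eq bx. Qed.

Definition tower (x : int -> bool) := forall n, exists p a, parse n p a x.

(** The point is built at level [n] alone: a relabelling at a higher level is also one at level [n],
    hence the same point by uniqueness. *)
Lemma tower_relabel n g x : g \in E n -> tower x ->
  exists y, tower y /\ forall m, (n <= m)%N -> relabel m g x y.
Proof.
move=> gE tx.
have r m : (n <= m)%N -> exists y, relabel m g x y.
  move=> nm; have [p [a px]] := tx m; exact: relabel_ex (E_le nm gE) px.
have [y ry] := r n (leqnn n); exists y.
have ry' m : (n <= m)%N -> relabel m g x y.
  move=> nm; have [y' ry'] := r m nm; have := relabel_le nm gE ry' => ry2.
  have yy := relabel_uniq ry2 ry.
  have [p [a [px py]]] := ry'; exists p, a; split=> //; exact: parse_ext py.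
split=> // m; have [p [a [_ py]]] := ry' (maxn n m) (leq_maxl _ _).
have mm := leq_maxr n m.
move: (fun k => lact g (a k)) py => b; rewrite -(subnKC mm).
elim: (maxn n m - m)%N b => [|d IH] b; first by rewrite addn0; exists p, b.
rewrite addnS => py; have c0 : (0 < cnt (m + d))%N by have := cnt_ge (m + d); lia.
exact: IH (parse_down (spreadP (theta (m + d)) c0 0 b) py).
Qed.

(* A translation by [s] preserves the cuts of level [m] only if [len m] divides [s]. *)
Lemma relabel_shift_trivial n g x y (s : int) :
  (forall m, (n <= m)%N -> relabel m g x y) -> (forall z, y z = x (z + s)) -> g = 1%g.
Proof.
move=> r ys; set m := (n + `|s|)%N.
have [p [a [px py]]] := r m (leq_addr _ _).
have := parse_ext (fun z => esym (ys z)) (parse_shift s px).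
move=> /(parse_uniq py) [t [tE aE]].
have lm : (m < len m)%N := len_gt m.
have t0 : t = 0 by rewrite /m in lm tE; nia.
have := aE 0; rewrite t0 addr0 => /(congr1 fst) /= e.
by apply: (@mulIg _ (a 0).1); rewrite mul1g.
Qed.

(** * Locally determined points are relabellings *)

Lemma theta_tail n i j : (hd n <= j)%N -> theta n i j = (part n i.1, false).
Proof. by move=> hj; rewrite /theta template_tail // /lact /= mulg1. Qed.

(* The part of a block that precedes the final run begins and ends with the bit [true], while
   the run has bits [false]. *)
Lemma constant_run n q v u (s : int) (r : nat) : blocks (cnt n) (theta n) q v u ->
  (hd n < r)%N -> (forall z : int, s <= z < s + r%:Z -> u z = u s) ->
  exists k : int, q + k * (cnt n)%:Z + (hd n)%:Z <= s /\ s + r%:Z <= q + (k + 1) * (cnt n)%:Z.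
Proof.
move=> bu hr us; have cn := cnt_ge n; have hc := hd_lt_cnt n.
have c0 : (0 < cnt n)%N by lia.
have [k [j [jc sE]]] := block_decomp c0 q s.
have bit (k' : int) (i : nat) : (i < cnt n)%N ->
    s <= q + k' * (cnt n)%:Z + i%:Z < s + r%:Z ->
    (template n (code n (v k')) i).2 = (u s).2.
  by move=> ic /us <-; rewrite bu // theta_bit.
have h2 : (2 <= hd n)%N by rewrite /hd; lia.
exists k; have [jh|jh] := ltnP j (hd n).
  have e1 := bit k (hd n).-1 ltac:(lia) ltac:(lia); rewrite template_pre_tail in e1.
  by have := bit k (hd n) hc ltac:(lia); rewrite template_tail // -e1.
split; first lia.
rewrite leNgt; apply/negP => lt.
have e1 := bit (k + 1) 0 c0 ltac:(lia); rewrite template_marker // in e1.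
by have := bit k j jc ltac:(lia); rewrite template_tail // -e1.
Qed.

(** The bounds on [e] fit a sum of two offsets below [len n] and a displacement within the coding
    radius; such a sum meets four blocks. *)
Lemma parse_window n p a x (k k' e : int) : parse n p a x ->
  (forall i : int, -1 <= i <= 2 -> a (k + i) = a (k' + i)) ->
  - (len n)%:Z <= e < 3 * (len n)%:Z ->
  x (p + k * (len n)%:Z + e) = x (p + k' * (len n)%:Z + e).
Proof.
move=> [al bx] aE eb; have [i [j [jl eE]]] := block_decomp (len_gt0 n) 0 e.
subst e; have l0 := len_gt0 n.
have h (k0 : int) : p + k0 * (len n)%:Z + (0 + i * (len n)%:Z + j%:Z) =
  p + (k0 + i) * (len n)%:Z + j%:Z by ring.
by rewrite !h !bx // aE //; nia.
Qed.

Lemma locally_determined_relabel x y (r : nat) : tower x -> tower y ->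
  (forall i j : int, (forall t : int, - r%:Z <= t <= r%:Z -> x (i + t) = x (j + t)) -> y i = y j) ->
  exists n g s, g \in E n /\ relabel n g x (fun z => y (z + s)).
Proof.
move=> tx ty loc; set n := r.
have rl : (r < len n)%N := len_gt r.
have [p [a2 px2]] := tx n.+2; have [p' [b2 py2]] := ty n.+2.
have c0 m : (0 < cnt m)%N by have := cnt_ge m; lia.
have ba2 := spreadP (theta n.+1) (c0 n.+1) 0 a2.
have px1 := parse_down ba2 px2; move: (spread _ _ _ _) ba2 px1 => a1 ba2 px1.
have ba1 := spreadP (theta n) (c0 n) 0 a1.
have px0 := parse_down ba1 px1; move: (spread _ _ _ _) ba1 px0 => a0 ba1 px0.
have bb2 := spreadP (theta n.+1) (c0 n.+1) 0 b2.
have py1 := parse_down bb2 py2; move: (spread _ _ _ _) bb2 py1 => b1 bb2 py1.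
have bb1 := spreadP (theta n) (c0 n) 0 b1.
have py0 := parse_down bb1 py1; move: (spread _ _ _ _) bb1 py0 => b0 bb1 py0.
have [t [d [dl p'E]]] := block_decomp (len_gt0 n) p p'.
(* The cuts of [y] lie [t] blocks and [d] bits after those of [x], so a label of [y] depends on four
   labels of [x]. *)
have loc0 (k k' : int) : (forall i : int, -1 <= i <= 2 -> a0 (k + t + i) = a0 (k' + t + i)) ->
    b0 k = b0 k'.
  move=> aE; apply: (word_inj (proj1 py0 k) (proj1 py0 k')) => j jl.
  rewrite -(proj2 py0) // -(proj2 py0) //; apply: loc => w wr.
  have h (k0 : int) : p' + k0 * (len n)%:Z + j%:Z + w =
    p + (k0 + t) * (len n)%:Z + (d%:Z + j%:Z + w) by rewrite p'E; ring.
  rewrite !h; apply: (parse_window px0 aE); lia.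
have NL := N_large n; have NL1 := N_large n.+1.
have cn : cnt n = (hd n + N n)%N by [].
have cn1 : cnt n.+1 = (hd n.+1 + N n.+1)%N by [].
(* The final run of a block of [x] yields a run of [y] that is shorter by at most three, hence the
   displacement [t] is close to a multiple of [cnt n]. *)
have [k [k1 k2]] : exists k : int, 0 + k * (cnt n)%:Z + (hd n)%:Z <= (hd n)%:Z + 1 - t /\
    (hd n)%:Z + 1 - t + (N n - 3)%N%:Z <= 0 + (k + 1) * (cnt n)%:Z.
  apply: (constant_run bb1); first lia.
  have tail (z : int) : (hd n)%:Z <= z < (cnt n)%:Z -> a0 z = (part n (a1 0).1, false).
    move=> zb; have := ba1 0 `|z|%N ltac:(lia); rewrite theta_tail; last lia.
    by move=> <-; congr a0; lia.
  move=> z zb; apply: loc0 => i ib; rewrite !tail //; lia.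
have [T [tau [taub tE]]] : exists T tau : int, -2 <= tau <= 1 /\ t = T * (cnt n)%:Z + tau.
  by exists (- k), (t + k * (cnt n)%:Z); split; [lia | ring].
(* With this small displacement, a label of [y] of level [n.+1] depends on one label of [x]. *)
have loc1 (i j : int) : a1 (i + T) = a1 (j + T) -> b1 i = b1 j.
  move=> aE; apply: (theta_inj_interior (proj1 py1 i) (proj1 py1 j)) => w w3 wh.
  have hc := hd_lt_cnt n.
  rewrite -bb1; last lia. rewrite -bb1; last lia.
  apply: loc0 => e eb.
  have h (k0 : int) : 0 + k0 * (cnt n)%:Z + w%:Z + t + e =
      0 + (k0 + T) * (cnt n)%:Z + (absz (w%:Z + tau + e))%:Z.
    have -> : (absz (w%:Z + tau + e))%:Z = w%:Z + tau + e by lia.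
    by rewrite tE; ring.
  rewrite !h !ba1 ?aE //; lia.
(* Runs of [x] at level [n.+1] now yield runs of [y] of full length: no displacement is left. *)
have [l [l1 l2]] : exists k : int, 0 + k * (cnt n.+1)%:Z + (hd n.+1)%:Z <= (hd n.+1)%:Z - T /\
    (hd n.+1)%:Z - T + (N n.+1)%:Z <= 0 + (k + 1) * (cnt n.+1)%:Z.
  apply: (constant_run bb2); first lia.
  have tail (z : int) : (hd n.+1)%:Z <= z < (cnt n.+1)%:Z -> a1 z = (part n.+1 (a2 0).1, false).
    move=> zb; have := ba2 0 `|z|%N ltac:(lia); rewrite theta_tail; last lia.
    by move=> <-; congr a1; lia.
  move=> z zb; apply: loc1; rewrite !tail //; lia.
have TE : T = - l * (cnt n.+1)%:Z by lia.
pose ka := part n.+1 (a2 0).1; pose kb := part n.+1 (b2 l).1.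
have kaE : ka \in E n.+1 by exact: part_mem.
have kbE : kb \in E n.+1 by exact: part_mem.
(* Without this shift, the offset from [p] to [p'] is [T] whole words of level [n.+1]. *)
exists n.+1, (kb * ka^-1)%g, (tau * (len n)%:Z + d%:Z); split; first exact: E_div.
exists p, a1; split=> //.
(* Block 0 of [a2] contains [ka] times every label, so [a1 (i + T)] occurs there at some [j]. By
   [loc1], [b1 i] is the letter at [j] in block [l] of [b2], which is [kb] times the same label of
   the template. *)
have b1E i : b1 i = lact (kb * ka^-1) (a1 (i + T)).
  set u := lact ka^-1%g (a1 (i + T)).
  have ul : u \in labels n.+1 by rewrite lact_labels ?E_V //; exact: proj1 px1 _.
  have [j [j3 jh jE]] := template_pair ul ul; have hc := hd_lt_cnt n.+1.
  have jc : (j < cnt n.+1)%N by lia.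
  have aj : a1 j%:Z = a1 (i + T).
    have := ba2 0 j jc; rewrite mul0r !add0r => ->.
    by rewrite /theta (proj1 (jE _)) lactVK.
  rewrite (loc1 i (0 + l * (cnt n.+1)%:Z + j%:Z)).
    by rewrite bb2 // /theta (proj1 (jE _)) lactM.
  by rewrite -aj; congr a1; rewrite TE; ring.
have := parse_shift (tau * (len n)%:Z + d%:Z) py1.
have -> : p' - (tau * (len n)%:Z + d%:Z) = p + T * (len n.+1)%:Z.
  by rewrite p'E tE /= PoszM; ring.
move=> /(parse_translate (- T)); have -> : p + T * (len n.+1)%:Z + - T * (len n.+1)%:Z = p by ring.
move=> [bl by_]; split=> [i|]; first by have := bl i; rewrite b1E subrK.
by apply: blocks_eq by_ => // i; rewrite b1E subrK.
Qed.

(** * Patterns inside two consecutive words: minimality and counting *)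

Definition two_words n (i i' : label) (t : nat) : bool :=
  if (t < len n)%N then word n i t else word n i' (t - len n).

Lemma parse_two_words n p a x (k : int) (t : nat) : parse n p a x -> (t < 2 * len n)%N ->
  x (p + k * (len n)%:Z + t%:Z) = two_words n (a k) (a (k + 1)) t.
Proof.
move=> [_ bx] tl; rewrite /two_words; case: ltnP => h; first exact: bx.
rewrite -bx; last lia.
by congr x; lia.
Qed.

(** The pattern lies in two consecutive words of [x]. A block of [y] contains [g] times every pair
    of labels, in particular the pair [a k], [a (k + 1)], found as the translate by [g] of its image
    under the inverse of [g]. *)
Lemma tower_minimal x y (z : int) (l : nat) : tower x -> tower y ->
  exists z' : int, forall j : nat, (j < l)%N -> y (z' + j%:Z) = x (z + j%:Z).
Proof.
move=> tx ty; set n := l; have ll : (l < len n)%N := len_gt l.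
have [p [a px]] := tx n; have [q [b py]] := ty n.+1.
have c0 : (0 < cnt n)%N by have := cnt_ge n; lia.
have bb := spreadP (theta n) c0 0 b; have qy := parse_down bb py.
move: (spread _ _ _ _) bb qy => b0 bb qy.
have [k [i [il ->]]] := block_decomp (len_gt0 n) p z.
pose g := part n (b 0).1; have gE : g \in E n by exact: part_mem.
have al w : lact g^-1%g (a w) \in labels n by rewrite lact_labels ?E_V //; exact: proj1 px w.
have [w [_ wh wE]] := template_pair (al k) (al (k + 1)).
have hc := hd_lt_cnt n.
have bw : b0 w%:Z = a k.
  have := bb 0 w ltac:(lia); rewrite mul0r !add0r => ->.
  by rewrite /theta (proj1 (wE _)) lactVK.
have bw1 : b0 (w%:Z + 1) = a (k + 1).
  have := bb 0 w.+1 ltac:(lia); rewrite mul0r !add0r -addn1 PoszD => ->.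
  by rewrite /theta addn1 (proj2 (wE _)) lactVK.
exists (q + w%:Z * (len n)%:Z + i%:Z) => j jl.
have ij (u : int) : u + i%:Z + j%:Z = u + (i + j)%N%:Z by lia.
rewrite !ij (parse_two_words _ px); last lia.
by rewrite (parse_two_words _ qy) ?bw ?bw1 //; lia.
Qed.

(** The starts left out give patterns inside the final run, which has period [len n]; they recur
    from a start in the first period of the run. Starts in the last [l] positions may reach the
    second word. *)
Definition tower_words n l : seq (seq bool) :=
  [seq mkseq (fun j => two_words n.+1 ii.1 ii.2 (t + j)) l
  | ii <- [seq (i, i') | i <- labels n.+1, i' <- labels n.+1],
    t <- iota 0 ((hd n + 1) * len n) ++ iota (len n.+1 - l) l].

Lemma size_tower_words n l : size (tower_words n l) =
  (size (labels n.+1) ^ 2 * ((hd n + 1) * len n + l))%N.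
Proof. by rewrite !size_allpairs size_cat !size_iota mulnn. Qed.

Lemma word_tail n i t : (hd n * len n <= t < len n.+1)%N ->
  word n.+1 i t = word n (part n i.1, false) (t %% len n).
Proof.
move=> /andP[ht tl] /=; rewrite theta_tail //.
by rewrite leq_divRL ?len_gt0.
Qed.

Lemma mem_tower_words n l x (z : int) : tower x -> (l <= len n.+1)%N ->
  mkseq (fun j => x (z + j%:Z)) l \in tower_words n l.
Proof.
move=> tx ll; have [p [a px]] := tx n.+1; have l0 := len_gt0 n.
have [k [t [tl ->]]] := block_decomp (len_gt0 n.+1) p z.
have xE : mkseq (fun j => x (p + k * (len n.+1)%:Z + t%:Z + j%:Z)) l =
          mkseq (fun j => two_words n.+1 (a k) (a (k + 1)) (t + j)) l.
  apply/(@eq_from_nth _ false); rewrite !size_mkseq // => j jl.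
  by rewrite !nth_mkseq // -addrA -PoszD (parse_two_words _ px); last lia.
rewrite xE /tower_words.
have ain w : a w \in labels n.+1 by exact: proj1 px w.
have [h|h] := boolP (t \in iota 0 ((hd n + 1) * len n) ++ iota (len n.+1 - l) l).
  by apply/allpairsP; exists ((a k, a (k + 1)), t); split=> //=; exact: allpairs_f.
move: h; rewrite mem_cat !mem_iota => h.
have hdl : (hd n * len n + len n <= len n.+1)%N.
  by rewrite /= -mulSnr leq_mul2r hd_lt_cnt orbT.
have [h1 h2] : ((hd n + 1) * len n <= t /\ t + l <= len n.+1)%N by lia.
apply/allpairsP; exists ((a k, a (k + 1)), (hd n * len n + t %% len n)%N); split=> /=.
- exact: allpairs_f.
- by rewrite mem_cat mem_iota; have := ltn_pmod t l0; lia.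
apply/(@eq_from_nth _ false); rewrite !size_mkseq // => j jl.
have t' : (hd n * len n + t %% len n <= t)%N.
  rewrite {2}(divn_eq t (len n)) leq_add2r leq_mul2r leq_divRL // orbC.
  by move: h1; rewrite mulnDl; lia.
rewrite !nth_mkseq // /two_words !ifT //; [|lia|lia].
rewrite !word_tail //; [|lia|lia].
by rewrite -addnA modnMDl modnDml.
Qed.

End Substitutions.

(** * Automorphisms of subshifts *)

Section Windows.
Variable A : finType.
Local Notation fullshift := (fullshift A).

Definition agree (r : nat) (x y : int -> A) :=
  forall t : int, - r%:Z <= t <= r%:Z -> x t = y t.

Lemma coord_nbhs (x : fullshift) (z : int) : nbhs x [set y : fullshift | y z = x z].
Proof.
apply: (@proj_continuous _ (fun=> discrete_topology A) z x [set a | a = x z]).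
exact: discrete_set1.
Qed.

Lemma window_nbhs (x : fullshift) (r : nat) :
  nbhs x [set y : fullshift | agree r y x].
Proof.
have FF : Filter (nbhs x) by exact: nbhs_filter.
have h := @filter_forall _ 'I_(2 * r).+1
  (fun i => [set y : fullshift | y (i%:Z - r%:Z) = x (i%:Z - r%:Z)]) (nbhs x)
  FF (fun i => coord_nbhs x _).
apply: filterS h => y yx t tr; have ti : (absz (t + r%:Z)%R < (2 * r).+1)%N by lia.
have := yx (Ordinal ti); suff -> : (Ordinal ti)%:Z - r%:Z = t by [].
rewrite /=; lia.
Qed.

Lemma closed_windowP (X : set fullshift) :
  (forall x, (forall r, exists2 y, X y & agree r y x) -> X x) -> closed X.
Proof.
move=> h x cx; apply: h => r.
by have [y [Xy yx]] := cx _ (window_nbhs x r); exists y.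
Qed.

Lemma fullshift_compact : compact [set: fullshift].
Proof.
have cA (z : int) : compact [set: discrete_topology A].
  by apply: finite_compact; exact: (@finite_finset A).
have := @tychonoff int (fun=> discrete_topology A) (fun=> setT) cA.
by congr compact; apply/seteqP; split.
Qed.

Lemma compact_seq_cluster (u : nat -> fullshift) :
  exists c : fullshift, forall r n, exists2 m, (n <= m)%N & agree r (u m) c.
Proof.
have [//|c [_ cc]] := fullshift_compact (F := u @ \oo) _ _; first exact: filterT.
exists c => r n.
have [] := cc (u @` [set m | (n <= m)%N]) _ _ (window_nbhs c r).
  by exists n => // m /= nm; exists m.
by move=> _ [[m nm <-] um]; exists m.
Qed.

Lemma agree_le r r' x y : (r <= r')%N -> agree r' x y -> agree r x y.
Proof. by move=> rr xy t tr; apply: xy; lia. Qed.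

Lemma agree_sym r x y : agree r x y -> agree r y x.
Proof. by move=> xy t /xy. Qed.

Lemma agree_trans r x y z : agree r x y -> agree r y z -> agree r x z.
Proof. by move=> xy yz t tr; rewrite xy // yz. Qed.

(** The filter generated by windows converges to [x]: the product topology is a supremum over
    coordinates, and radius [|z|] controls coordinate [z]. *)
Lemma nbhs_window (x : fullshift) (U : set fullshift) : nbhs x U ->
  exists r, forall y, agree r y x -> U y.
Proof.
pose F := filter_from [set: nat] (fun r => [set y : fullshift | agree r y x]).
have FF : Filter F.
  apply: filter_from_filter; first by exists 0%N.
  move=> i j _ _; exists (maxn i j) => // y yx.
  by split; apply: agree_le yx; rewrite ?leq_maxl ?leq_maxr.
have Fx : F --> x.
  apply/cvg_sup => z V [_ [[W oW <-] /= Wx WV]].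
  exists `|z|%N => // y yx; apply: WV => /=; rewrite yx //; lia.
by move=> /Fx [r _ h]; exists r => y yx; exact: h.
Qed.

Variable X : subshift A.

Lemma continuousX_window (phi : X -> X) (x : X) : continuous phi ->
  exists r, forall y : X, agree r (val y) (val x) -> val (phi y) 0 = val (phi x) 0.
Proof.
move=> cphi.
have := cphi x (val @^-1` [set y : fullshift | y 0 = val (phi x) 0]).
have cv : continuous (val : X -> fullshift) by exact: initial_continuous.
move=> /(_ (cv _ _ (coord_nbhs _ _))) [_ [[W oW <-] /= Wx WU]].
have [r h] := nbhs_window (open_nbhs_nbhs (conj oW Wx)).
by exists r => y yx; apply: WU; exact: h.
Qed.

(** Compactness: otherwise bad pairs exist for every radius, and they accumulate at a point where
    continuity fails. *)
Lemma continuousX_uniform (phi : X -> X) : continuous phi ->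
  exists r, forall x y : X, agree r (val x) (val y) -> val (phi x) 0 = val (phi y) 0.
Proof.
move=> cphi; apply/not_existsP => nr.
have bad r : exists xy : X * X, agree r (val xy.1) (val xy.2) /\
    val (phi xy.1) 0 <> val (phi xy.2) 0.
  have /existsNP [x /existsNP [y /not_implyP [xy nxy]]] := nr r.
  by exists (x, y).
have [xy xyP] := choice bad.
have [c cc] := compact_seq_cluster (fun n => val (xy n).1).
have Xc : subshift_set X c.
  apply: subshift_closed => U /nbhs_window [r Ur]; have [m _ /Ur Um] := cc r 0%N.
  by exists (val (xy m).1); split=> //; exact: set_valP.
pose cX : X := exist _ c (mem_set Xc).
have [r rP] := continuousX_window cX cphi.
have [m rm /= mc] := cc r r.
have [h] := xyP m; rewrite (rP _ mc) (rP (xy m).2) //.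
apply: agree_trans mc; apply: agree_sym; exact: agree_le h.
Qed.

(** * Translations and the subgroup generated by the shift *)

Lemma translate_mem (x : fullshift) (s : int) :
  subshift_set X x -> subshift_set X (fun z => x (z + s)).
Proof.
have pos (n : nat) y : subshift_set X y -> subshift_set X (fun z => y (z + n%:Z)).
  elim: n y => [|n IH] y Xy; first by under eq_fun do rewrite addr0.
  rewrite -subshift_shift; exists (fun z => y (z + n%:Z)); first exact: IH.
  by apply/funext => z; rewrite /Defs.shift; congr y; lia.
have neg (n : nat) y : subshift_set X y -> subshift_set X (fun z => y (z - n%:Z)).
  elim: n y => [|n IH] y Xy; first by under eq_fun do rewrite subr0.
  have := IH _ Xy; rewrite -{1}subshift_shift => -[y' Xy' y'E].
  suff -> : (fun z => y (z - n.+1%:Z)) = y' by [].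
  apply/funext => z; transitivity (Defs.shift y' (z - 1)); first by rewrite y'E; congr y; lia.
  by rewrite /Defs.shift; congr y'; lia.
case: s => n; [exact: pos | rewrite NegzE; exact: neg].
Qed.

Definition translate (s : int) (x : X) : X :=
  exist _ (fun z => val x (z + s)) (mem_set (translate_mem s (set_valP x))).

Lemma aut_translate (phi : Aut X) s x : val phi (translate s x) = translate s (val phi x).
Proof.
have /set_mem[_ phis] := valP phi.
have pos (n : nat) y : val phi (translate n%:Z y) = translate n%:Z (val phi y).
  elim: n => [|n IH].
    have t0 w : translate 0 w = w.
      by apply: val_inj; apply/funext => z /=; rewrite addr0.
    by rewrite !t0.
  have tS w : translate n.+1%:Z w = shiftX (translate n%:Z w).
    by apply: val_inj; apply/funext => z /=; rewrite /Defs.shift; congr (val w); lia.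
  by rewrite !tS -IH; exact: (congr1 (@^~ (translate n%:Z y)) phis).
case: s => n; first exact: pos.
have tK w : translate n.+1%:Z (translate (Negz n) w) = w.
  by apply: val_inj; apply/funext => z /=; congr (val w); lia.
have tK' w : translate (Negz n) (translate n.+1%:Z w) = w.
  by apply: val_inj; apply/funext => z /=; congr (val w); lia.
by rewrite -{2}[x]tK pos tK'.
Qed.

(* One half of the Curtis-Hedlund-Lyndon theorem. *)
Lemma aut_block_code (phi : Aut X) :
  exists r : nat, forall (x y : X) (i j : int),
    (forall t : int, - r%:Z <= t <= r%:Z -> val x (i + t) = val y (j + t)) ->
    val (val phi x) i = val (val phi y) j.
Proof.
have /set_mem[[cphi _] _] := valP phi.
have [r rP] := continuousX_uniform cphi; exists r => x y i j e.
have := rP (translate i x) (translate j y); rewrite !aut_translate /= !add0r; apply.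
by move=> t tr; rewrite /= addrC e // addrC.
Qed.

Lemma aut_mulE (phi psi : Aut X) x : val (phi * psi)%g x = val phi (val psi x).
Proof. by []. Qed.

Lemma aut_mulVE (phi : Aut X) x : val phi (val phi^-1%g x) = x.
Proof. by rewrite -aut_mulE mulgV. Qed.

Definition is_translation (phi : Aut X) (s : int) :=
  forall x z, val (val phi x) z = val x (z + s).

Lemma is_translationV phi s : is_translation phi s -> is_translation phi^-1%g (- s).
Proof.
move=> h x z; have := h (val phi^-1%g x) (z - s); rewrite aut_mulVE subrK.
by move=> ->.
Qed.

Lemma is_translationM phi psi s t : is_translation phi s -> is_translation psi t ->
  is_translation (phi * psi)%g (s + t).
Proof. by move=> h h' x z; rewrite aut_mulE h h' addrA. Qed.

Lemma shift_aut_expg n : is_translation (shift_aut X ^+ n)%g n%:Z.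
Proof.
elim: n => [|n IH] x z; first by rewrite addr0.
by rewrite expgS aut_mulE /= /Defs.shift IH; congr (val x); lia.
Qed.

Lemma translation_ex (s : int) : exists phi, is_translation phi s.
Proof.
case: s => n; first by exists (shift_aut X ^+ n)%g; exact: shift_aut_expg.
exists (shift_aut X ^+ n.+1)%g^-1%g; rewrite NegzE.
exact: is_translationV (@shift_aut_expg n.+1).
Qed.

Lemma shift_subgroupP (phi : Aut X) :
  nsub_set (shift_subgroup X) phi <-> exists s, is_translation phi s.
Proof.
split.
  move=> /(_ [set phi | exists s, is_translation phi s]); apply; split; last first.
    by move=> _ ->; exists 1.
  split; first by rewrite inE; exists 0 => x z; rewrite addr0.
  move=> f g; rewrite !inE => -[s fs] [t gt]; exists (s - t).
  by apply: is_translationM => //; exact: is_translationV.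
have pos (n : nat) psi : is_translation psi n%:Z -> nsub_set (shift_subgroup X) psi.
  move=> h; suff -> : psi = (shift_aut X ^+ n)%g.
    move=> H [[/set_mem H1 HM] Hs]; have Hz : H (shift_aut X) by exact: Hs.
    have HV a : H a -> H a^-1%g.
      by move=> Ha; have := HM _ _ (mem_set H1) (mem_set Ha); rewrite inE mul1g.
    elim: n {h} => // n IH; rewrite expgS.
    have := HM _ _ (mem_set Hz) (mem_set (HV _ IH)); by rewrite inE invgK.
  apply: val_inj; apply/funext => x; apply: val_inj; apply/funext => z.
  by rewrite h shift_aut_expg.
case=> -[n|n] h; first exact: pos h.
have := pos n.+1 _ (is_translationV h).
move=> hV; have [H1 HM] := subgroup_genP [set shift_aut X].
by have := HM _ _ H1 (mem_set hV); rewrite inE mul1g invgK.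
Qed.

(** By minimality every window of [x] occurs in [x0], where the two block codes give the same
    letter. *)
Lemma aut_eq_at (phi psi : Aut X) (x0 : X) : minimal X ->
  val phi x0 = val psi x0 -> phi = psi.
Proof.
move=> minX e; apply: val_inj; apply/funext => x; apply: val_inj; apply/funext => z.
have [r rP] := aut_block_code phi; have [r' rP'] := aut_block_code psi.
pose R := maxn r r'.
pose w := mkseq (fun i => val x (z - R%:Z + i%:Z)) (2 * R).+1.
have [|k wk] := minX w (val x0) _ (set_valP x0).
  exists (val x); first exact: set_valP.
  by exists (z - R%:Z); rewrite size_mkseq.
have loc (t : int) : - R%:Z <= t <= R%:Z -> val x (z + t) = val x0 (k + R%:Z + t).
  move=> tR; have := congr1 (fun s => nth (val x z) s (absz (t + R%:Z)%R)) wk.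
  rewrite /w size_mkseq !nth_mkseq; [|lia|lia].
  have -> : z - R%:Z + (absz (t + R%:Z)%R)%:Z = z + t by lia.
  by have -> : k + (absz (t + R%:Z)%R)%:Z = k + R%:Z + t by lia.
rewrite (rP x x0 z (k + R%:Z)); last by move=> t tr; apply: loc; rewrite /R; lia.
rewrite (rP' x x0 z (k + R%:Z)) ?e //; by move=> t tr; apply: loc; rewrite /R; lia.
Qed.

End Windows.

(** * The subshift of a chain of finite groups *)

Section TowerSubshift.
Variables (G : groupType) (E : nat -> seq G) (N : nat -> nat).
Hypothesis adm : admissible E N.
Hypothesis E_cover : forall g, exists n, g \in E n.
Local Notation fullshift := (fullshift bool).

(* By recognizability, all the approximants are cut at the same places as [y0]. *)
Lemma parse_limit n (x : int -> bool) :
  (forall r, exists y : int -> bool, (exists p a, parse E N n p a y) /\ agree r y x) ->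
  exists p a, parse E N n p a x.
Proof.
move=> lim; have l0 := len_gt0 adm n.
have [y0 [[p [a0 py0]] y0x]] := lim (2 * len E N n)%N.
have lab (k : int) : exists i, i \in labels E n /\ forall j, (j < len E N n)%N ->
    x (p + k * (len E N n)%:Z + j%:Z) = word E N n i j.
  (* The radius covers both the window that fixes the cuts and the block of index [k]. *)
  have [y [[q [a py]] yx]] :=
    lim (2 * len E N n + `|p| + (`|k| + 1) * len E N n)%N.
  have [t qE] : exists t, p = q + t * (len E N n)%:Z.
    apply: (parse_recognizable adm (s := 0) py py0) => z zr.
    rewrite yx ?y0x //; lia.
  have := parse_translate t py; rewrite -qE => -[al bl].
  exists (a (k + t)); split=> // j jl; rewrite -bl // yx //.
  have : (absz (k * (len E N n)%:Z)%R = `|k| * len E N n)%N by rewrite abszM.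
  lia.
have [a aP] := choice lab.
by exists p, a; split=> [k|k j jl]; [have [] := aP k | have [_ ->] := aP k].
Qed.

Lemma parse_le n m p a (x : int -> bool) : (n <= m)%N -> parse E N m p a x ->
  exists b, parse E N n p b x.
Proof.
move=> /subnKC <-; elim: (m - n)%N a => [|d IH] a; first by rewrite addn0; exists a.
rewrite addnS => px; apply: IH (parse_down adm (spreadP _ _ _ _) px).
by have := cnt_ge adm (n + d); lia.
Qed.

Definition tower_set : set fullshift := [set x | tower E N x].

Lemma tower_closed : closed tower_set.
Proof.
apply: closed_windowP => x lim n; apply: parse_limit => r.
by have [y ty yx] := lim r; exists y; split; first exact: ty.
Qed.

Lemma tower_translate x (s : int) : tower E N x -> tower E N (fun z => x (z + s)).
Proof. by move=> tx n; have [p [a px]] := tx n; exists (p - s), a; exact: parse_shift. Qed.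

Lemma tower_shift : (@Defs.shift bool) @` tower_set = tower_set.
Proof.
apply/seteqP; split=> [_ [x tx <-]|x tx]; first exact: tower_translate.
exists (fun z => x (z - 1)); first exact: tower_translate.
by apply/funext => z; rewrite /Defs.shift; congr x; lia.
Qed.

Definition tower_subshift : subshift bool := Subshift tower_closed tower_shift.
Local Notation X := tower_subshift.

(** Periodic sequences of words of level [m] have parsings of all levels up to [m]; a cluster point
    as [m] grows has parsings of all levels. *)
Lemma tower_nonempty : (X : set fullshift) !=set0.
Proof.
have ex n : exists x : fullshift, exists p a, parse E N n p a x.
  exists (spread (len E N n) (word E N n) 0 (fun=> (1%g, false))), 0, (fun=> (1%g, false)).
  split; last exact: spreadP (len_gt0 adm n) _ _.
  by move=> _; rewrite mem_labels (E_1 adm).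
have [u uP] := choice ex; have [c cc] := compact_seq_cluster u.
exists c => n; apply: parse_limit => r; have [m nm mc] := cc r n.
exists (u m); split=> //; have [p [a px]] := uP m; exists p; exact: parse_le px.
Qed.

Lemma tower_subshift_minimal : minimal X.
Proof.
move=> w y [x Xx [k wE]] Xy.
have [k' e] := tower_minimal adm k (size w) Xx Xy; exists k'.
rewrite [LHS]wE; apply/(@eq_from_nth _ false); rewrite !size_mkseq // => i iw.
by rewrite !nth_mkseq // e.
Qed.

Lemma relabel_exists (g : G) (x : X) :
  exists y : X, forall n, g \in E n -> relabel E N n g (val x) (val y).
Proof.
(* The least level whose group contains [g] lies below all other such levels. *)
case: (ex_minnP (E_cover g)) => n gE nmin.
have [y [ty r]] := tower_relabel adm gE (set_valP x).
by exists (exist _ (y : fullshift) (mem_set ty)) => m /nmin /r.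
Qed.

Definition gact (g : G) (x : X) : X := sval (cid (relabel_exists g x)).

Lemma gactP g x n : g \in E n -> relabel E N n g (val x) (val (gact g x)).
Proof. by rewrite /gact; case: cid => y /= h; exact: h. Qed.

Lemma gact_uniq g x n (y : X) : g \in E n -> relabel E N n g (val x) (val y) ->
  y = gact g x.
Proof.
move=> gE r; apply: val_inj; apply/funext => z.
exact: (relabel_uniq adm r (gactP x gE)).
Qed.

Lemma E_cover2 g h : exists n, g \in E n /\ h \in E n.
Proof.
have [n gE] := E_cover g; have [m hE] := E_cover h; exists (maxn n m).
by split; [exact: (E_le adm (leq_maxl _ _) gE) | exact: (E_le adm (leq_maxr _ _) hE)].
Qed.

Lemma gactM g h x : gact (g * h)%g x = gact g (gact h x).
Proof.
have [n [gE hE]] := E_cover2 g h; apply/esym; apply: (gact_uniq (E_M adm gE hE)).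
exact: (relabel_comp adm (gactP x hE) (gactP _ gE)).
Qed.

Lemma gact1 x : gact 1%g x = x.
Proof.
apply/esym; apply: (@gact_uniq _ _ 0%N); first exact: E_1 adm _.
by have [p [a px]] := set_valP x 0%N; exact: relabel_1 px.
Qed.

Lemma gact_shiftX g x : gact g (shiftX x) = shiftX (gact g x).
Proof.
have [n gE] := E_cover g; apply/esym/(gact_uniq gE).
exact: relabel_shift (gactP x gE).
Qed.

Lemma gact_continuous g : continuous (gact g).
Proof.
apply: continuous_comp_initial; apply: continuous_ptws => z x U Ux.
have [n gE] := E_cover g.
have FF : Filter (nbhs x) by exact: nbhs_filter.
have cv : continuous (val : X -> fullshift) by exact: initial_continuous.
have h : nbhs x [set y : X | agree (`|z| + 2 * len E N n) (val y) (val x)].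
  exact: (cv x _ (window_nbhs (val x) _)).
apply: filterS h => y /= yx.
suff e : val (gact g y) z = val (gact g x) z.
  by change (U (val (gact g y) z)); rewrite e; exact: nbhs_singleton Ux.
apply: (relabel_local adm (gactP y gE) (gactP x gE)) => t tb; apply: yx; lia.
Qed.

Lemma gact_automorphism g : gact g \in @automorphism bool X.
Proof.
rewrite inE; split; last by apply/funext => x; exact: gact_shiftX.
split; first exact: gact_continuous.
exists (gact g^-1%g); first exact: gact_continuous.
by split=> x; rewrite -gactM ?mulVg ?mulgV gact1.
Qed.

Definition gaut (g : G) : Aut X := exist _ (gact g) (gact_automorphism g).

Lemma gautM g h : gaut (g * h)%g = (gaut g * gaut h)%g.
Proof. by apply: val_inj; apply/funext => x; exact: gactM. Qed.

Lemma gaut_translation g s : is_translation (gaut g) s -> g = 1%g.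
Proof.
move=> gs; have [x0 tx0] := tower_nonempty; pose x : X := exist _ x0 (mem_set tx0).
have [n gE] := E_cover g.
apply: (relabel_shift_trivial adm (n := n) (x := val x) (y := val (gact g x)) (s := s)).
  by move=> m nm; apply: gactP; exact: (E_le adm nm gE).
exact: gs.
Qed.

(** [locally_determined_relabel] settles the matter at one point, and [aut_eq_at] extends it to all
    of [X]. *)
Lemma aut_decomp (phi : Aut X) : exists g s, is_translation ((gaut g)^-1 * phi)%g s.
Proof.
have [x0 tx0] := tower_nonempty; pose x : X := exist _ x0 (mem_set tx0).
have [r rP] := aut_block_code phi.
have [n [g [s [gE rel]]]] :=
  locally_determined_relabel adm (set_valP x) (set_valP (val phi x)) (fun i j => rP x x i j).
exists g, (- s); have [tau tauP] := translation_ex X (- s).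
have phix : translate s (val phi x) = val (gaut g) x by exact: (gact_uniq gE).
suff -> : ((gaut g)^-1 * phi)%g = tau by [].
apply: (aut_eq_at (x0 := x) tower_subshift_minimal).
have -> : val tau x = translate (- s) x by apply: val_inj; apply/funext => z; exact: tauP.
have -> : translate (- s) x = val ((gaut g)^-1 * gaut g)%g (translate (- s) x).
  by rewrite mulVg.
rewrite !aut_mulE aut_translate -phix; congr (val _ _).
by apply: val_inj; apply/funext => z /=; rewrite subrK.
Qed.

Let Q := quotient_group (shift_subgroup X).

Definition gquot (g : G) : Q := (\pi_Q (gaut g))%qT.

Lemma gquotM : {morph gquot : g h / (g * h)%g}.
Proof. by move=> g h; rewrite /gquot gautM; exact: Defs.pi_mul. Qed.

Lemma gquot_inj : injective gquot.
Proof.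
move=> g h /quot_relP; rewrite inE => /shift_subgroupP [s].
have -> : ((gaut g)^-1 * gaut h)%g = gaut (g^-1 * h)%g.
  by apply: (@mulgI _ (gaut g)); rewrite mulVKg -gautM mulVKg.
move=> /gaut_translation e; apply: (@mulgI _ g^-1%g); by rewrite e mulVg.
Qed.

Lemma gquot_surj q : exists g, gquot g = q.
Proof.
elim/quotW: q => phi; have [g [s gs]] := aut_decomp phi; exists g.
apply/quot_relP; rewrite inE; apply/shift_subgroupP; by exists s.
Qed.

Lemma tower_quotient_iso : isomorphic_groups Q G.
Proof.
have [f fK] := choice gquot_surj.
have Kf : cancel gquot f by move=> g; apply: gquot_inj; rewrite fK.
have fM : {morph f : x y / (x * y)%g}.
  by move=> x y; apply: gquot_inj; rewrite gquotM !fK.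
pose fm := HB.pack_for {multiplicative Q -> G} f (isMultiplicative.Build _ _ f fM).
by exists fm, gquot.
Qed.

End TowerSubshift.

Lemma complexity_le (A : finType) (X : set (fullshift A)) (n : nat) (s : seq (seq A)) :
  (forall w, language X w -> size w = n -> w \in s) -> (complexity X n <= size s)%N.
Proof.
move=> h; rewrite /complexity cardE -(size_map val); apply: uniq_leq_size.
  by rewrite map_inj_uniq ?enum_uniq //; exact: val_inj.
move=> _ /mapP [w + ->]; rewrite mem_enum !inE => wX.
by apply: h => //; rewrite size_tuple.
Qed.

(** * Exhausting a locally finite group by finite subgroups *)

Lemma subgroup_genS (G : groupType) (S S' : set G) : S `<=` S' ->
  subgroup_gen S `<=` subgroup_gen S'.
Proof. by move=> SS x Sx H [gH SH]; apply: Sx; split=> // y /SS /SH. Qed.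

Lemma subgroup_gen0 (G : groupType) : subgroup_gen (@set0 G) = [set 1%g].
Proof.
apply/seteqP; split=> [x|_ ->]; last by have [/set_mem] := subgroup_genP (@set0 G).
apply; split=> //; split; first by rewrite inE.
by move=> y z; rewrite !inE => /= -> ->; rewrite mulgV.
Qed.

Lemma locally_finite_exhaustion (G : groupType) :
  countable [set: G] -> locally_finite G ->
  exists E : nat -> seq G,
    [/\ E 0 =i [:: 1%g],
        forall n, 1%g \in E n,
        forall n g h, g \in E n -> h \in E n -> (g * h^-1)%g \in E n,
        forall n g, g \in E n -> g \in E n.+1 &
        forall g, exists n, g \in E n].
Proof.
move=> /countable_injP [c c_inj] lf.
(* Injectivity of [c] makes [S n] finite, and the empty [S 0] generates the trivial group required
   at level 0. *)
pose S n := [set g : G | (c g < n)%N].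
have finS n : finite_set (S n).
  apply: (@finite_preimage _ _ `I_n c); last exact: finite_II.
  by move=> g h _ _; apply: c_inj; rewrite inE.
have fin n : finite_set (subgroup_gen (S n)) by apply: lf.
exists (fun n => finmap.enum_fset (fset_set (subgroup_gen (S n)))).
have memE n g :
    (g \in finmap.enum_fset (fset_set (subgroup_gen (S n)))) = (g \in subgroup_gen (S n)).
  exact: (in_fset_set (fin n) g).
split=> [g|n|n g h|n g|g]; rewrite ?memE.
- have -> : S 0%N = set0 by apply/seteqP; split.
  by rewrite subgroup_gen0 inE; apply/idP/eqP => [/set_mem|->]; rewrite ?inE.
- by have [] := subgroup_genP (S n).
- by have [_] := subgroup_genP (S n); exact.
- by rewrite !inE; apply: subgroup_genS => k /= /leqW.
- exists (c g).+1; rewrite memE inE => H [_]; apply; exact: leqnn.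
Qed.

(** * Complexity of the tower subshift *)

Section Complexity.
Variables (G : groupType) (E : nat -> seq G) (N : nat -> nat).
Hypothesis adm : admissible E N.

(** The factor [hd E n + 2] bounds [(hd E n + 1) * len E N n + l] by a multiple of [l] once
    [len E N n <= l]. *)
Definition slope n : nat := (size (labels E n.+1) ^ 2 * (hd E n + 2))%N.

Lemma tower_complexity n l : (len E N n <= l <= len E N n.+1)%N ->
  (complexity (tower_subshift adm) l <= slope n * l)%N.
Proof.
move=> /andP[nl ln]; apply: leq_trans (complexity_le (s := tower_words E N n l) _) _.
  move=> w [x tx [k wE]] wl; rewrite wl in wE; rewrite wE.
  exact: (mem_tower_words adm _ tx ln).
rewrite size_tower_words /slope -mulnA leq_mul2l; apply/orP; right.
by rewrite !mulnDl mul1n; nia.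
Qed.

Lemma len_le n m : (n <= m)%N -> (len E N n <= len E N m)%N.
Proof.
move=> /subnKC <-; elim: (m - n)%N => [|d IH]; first by rewrite addn0.
by rewrite addnS /=; have := cnt_ge adm (n + d); nia.
Qed.

Lemma len_interval n0 l : (len E N n0 <= l)%N ->
  exists2 n, (n0 <= n)%N & (len E N n <= l < len E N n.+1)%N.
Proof.
move=> l0; have ex : exists m, (l < len E N m)%N by exists l; exact: len_gt adm l.
case: (ex_minnP ex) => -[|n] ln nmin; first by have := len_le (leq0n n0); lia.
have nl : (len E N n <= l)%N by rewrite leqNgt; apply/negP => /nmin; rewrite ltnn.
exists n; last by rewrite nl.
rewrite leqNgt; apply/negP => /len_le; lia.
Qed.

End Complexity.

(** * Run lengths adapted to the growth of [f] *)

Lemma nondecreasing_unbounded (R : realType) (f : nat -> R) :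
  nondecreasing_seq f -> ~ bounded_fun f -> forall c, exists n, c <= f n.
Proof.
move=> fi fu c; apply/not_existsP => h; apply: fu.
exists (Num.max `|c| `|f 0%N|); split; first exact: num_real.
move=> M cM n _ /=; apply: ltW; apply: le_lt_trans cM.
have f0 : f 0%N <= f n by exact: fi.
have fc : f n <= c by rewrite leNgt; apply/negP => /ltW /h.
rewrite ler_norml le_max; apply/andP; split.
  rewrite lerNl; apply: (@le_trans _ _ (- f 0%N)); first by rewrite lerN2.
  by rewrite le_max; apply/orP; right; rewrite -normrN; exact: ler_norm.
by rewrite (le_trans fc) ?ler_norm.
Qed.

Theorem theorem1p5 (R : realType) (G : groupType) (f : nat -> R)
    (G_countable : countable [set: G]) (G_locally_finite : locally_finite G)
    (f_increasing : nondecreasing_seq f) (f_unbounded : ~ bounded_fun f) :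
  exists (A : finType) (X : subshift A),
    [/\ X !=set0,
        minimal X,
        isomorphic_groups (quotient_group (shift_subgroup X)) G &
        (complexity X n)%:R / (n%:R * f n) @[n --> \oo] --> (0 : R)].
Proof.
have [E [E0 E1 Ediv ES Ecover]] := locally_finite_exhaustion G_countable G_locally_finite.
(* Runs of level [n] longer than [M n] give [len E N n.+1 >= M n], so from that length on [f]
   exceeds [n.+1] times the slope of level [n.+1]. *)
have [M MP] := choice (fun n =>
  nondecreasing_unbounded f_increasing f_unbounded (n.+1 * slope E n.+1)%:R).
pose N n := maxn (hd E n + 4) (M n).
have adm : admissible E N by split=> // n; exact: leq_maxl.
exists bool, (tower_subshift adm); split.
- exact: tower_nonempty.
- exact: tower_subshift_minimal.
- exact: tower_quotient_iso.
apply/cvgrPdist_le => e e0.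
have [n0 n0_gt0 en0] : exists2 n0 : nat, (0 < n0)%N & e^-1 < n0%:R.
  exists (Num.bound e^-1).+1 => //; apply: lt_trans (archi_boundP _) _.
    by rewrite invr_ge0 ltW.
  by rewrite ltr_nat.
exists (len E N n0) => // l l0.
(* Positivity of [n0] excludes level 0, about which [M] says nothing. *)
have [[|n] n0n /andP[nl ln]] := len_interval adm l0; first by case: n0 n0_gt0 n0n {l0 en0}.
have fl : (n.+1 * slope E n.+1)%:R <= f l.
  apply: le_trans (MP n) _; apply: f_increasing; apply: leq_trans nl => /=.
  have := len_gt0 adm n; have : (M n <= N n)%N by exact: leq_maxr.
  by rewrite /cnt; nia.
have cl := tower_complexity adm (l := l) (n := n.+1).
rewrite nl (ltnW ln) in cl; move/(_ isT): cl => cl.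
have ne : 1 <= e * n.+1%:R.
  rewrite mulrC -ler_pdivrMr // div1r ltW //.
  by apply: lt_le_trans en0 _; rewrite ler_nat.
have sl : (0 < slope E n.+1)%N.
  rewrite /slope muln_gt0 expn_gt0 addnS ltn0Sn andbT orbF size_allpairs muln_gt0 andbT.
  by case: (E _) (E1 n.+2).
have lgt : (0 < l)%N by apply: leq_trans nl; exact: len_gt0.
have fgt : 0 < f l by apply: lt_le_trans fl; rewrite ltr0n muln_gt0.
have lr : (0 : R) < l%:R by rewrite ltr0n.
rewrite sub0r normrN ger0_norm; last by rewrite divr_ge0 ?ler0n // mulr_ge0 // ltW.
rewrite ler_pdivrMr ?mulr_gt0 //.
apply: (@le_trans _ _ (slope E n.+1 * l)%:R); first by rewrite ler_nat.
rewrite natrM mulrC mulrCA ler_pM2l //.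
apply: (@le_trans _ _ (e * (n.+1 * slope E n.+1)%:R)); last by rewrite ler_pM2l.
by rewrite natrM mulrA ler_peMl.
Qed.
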